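(* Let $m\ge2$ and $G=CK(2m-1)$. Every set of edges $B\subset E(G)$ of Class B is a blocker for the simple Hamiltonian paths of $G$.
   Context: $CK(2m-1)$ is the complete convex geometric graph on $2m-1$ points in convex position, labelled clockwise $0,\dots,2m-2$ (elements of $\mathbb{Z}_{2m-1}$; indices mod $2m-1$), with all segments as edges. A simple Hamiltonian path (SHP) is a path through all vertices whose edges pairwise do not cross; a blocker for SHPs is an edge set of smallest possible size (which is $m$) sharing an edge with every SHP. Class B (up to cyclic rotation $x\mapsto x+k$ of labels): sets consisting of the following edges, for integers $\alpha,\delta\ge0$, $\beta,\gamma\ge2$ with $\alpha+\delta\le m-5$ and $\beta+\gamma=m-\alpha-\delta-1$: (1)–(2) all edges of the boundary paths $\langle\alpha,\dots,\alpha+\beta\rangle$ and $\langle\alpha+\beta+1,\dots,m-\delta\rangle$; (3) the edge $[\alpha+\beta-\eta,\,\alpha+\beta+1+\eta]$ for some integer $1\le\eta\le\min(\beta-1,\gamma-1)$; (4) the edges $[i-1-\epsilon_i,\,i+\epsilon_i]$, $1\le i\le\alpha$, with $\alpha+\beta-1>\epsilon_1>\dots>\epsilon_\alpha>0$; (5) the edges $[m-j-\xi_j,\,m-j+1+\xi_j]$, $1\le j\le\delta$, with $\gamma+\delta-1>\xi_1>\dots>\xi_\delta>0$. *)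

(* Defs.v *)
From mathcomp Require Import all_boot all_order all_algebra.
Set Implicit Arguments. Unset Strict Implicit. Unset Printing Implicit Defensive.
Import Order.TTheory GRing.Theory Num.Theory.

(* Vertices of CK(2m-1): labels 0..2m-2 (for m >= 1, (2*(m-1)).+1 = 2m-1),
   placed clockwise in convex position. *)
Definition VT (m : nat) := 'I_(2 * m.-1).+1.

Definition is_edge (m : nat) (e : {set VT m}) : bool := #|e| == 2.

Definition cross (m : nat) (e f : {set VT m}) : Prop :=
  exists a b c d : VT m,
    e = [set a; b] /\ f = [set c; d] /\
    ((a < c)%N && (c < b)%N && (b < d)%N).

Definition path_edges (m : nat) (p : seq (VT m)) : seq {set VT m} :=
  [seq [set x.1; x.2] | x <- zip p (behead p)].

Definition SHP (m : nat) (p : seq (VT m)) : Prop :=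
  uniq p /\ size p = #|VT m| /\
  (forall e f, e \in path_edges p -> f \in path_edges p -> ~ cross e f).

Definition blocks (m : nat) (B : {set {set VT m}}) : Prop :=
  forall p : seq (VT m), SHP p -> exists2 e, e \in path_edges p & e \in B.

Definition blocker (m : nat) (B : {set {set VT m}}) : Prop :=
  (forall e, e \in B -> is_edge e) /\ blocks B /\
  (forall C : {set {set VT m}},
      (forall e, e \in C -> is_edge e) -> blocks C -> (#|B| <= #|C|)%N).

Local Open Scope ring_scope.

Definition vtx (m : nat) (k x : int) : VT m :=
  inord (absz ((x + k) %% ((2 * m.-1).+1)%:Z)%Z).

Definition seg (m : nat) (k x y : int) : {set VT m} := [set vtx m k x; vtx m k y].

Definition classB (m : nat) (B : {set {set VT m}}) : Prop :=
  exists (k : int) (alpha delta beta gamma eta : nat) (eps xi : nat -> nat),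
    (2 <= beta)%N /\ (2 <= gamma)%N /\ (alpha + delta + 5 <= m)%N /\
    (beta + gamma = m - alpha - delta - 1)%N /\
    ((1 <= eta)%N /\ (eta <= minn (beta - 1) (gamma - 1))%N) /\
    ((0 < alpha)%N -> (eps 1%N < alpha + beta - 1)%N) /\
    (forall i, (1 <= i)%N -> (i < alpha)%N -> (eps i.+1 < eps i)%N) /\
    ((0 < alpha)%N -> (0 < eps alpha)%N) /\
    ((0 < delta)%N -> (xi 1%N < gamma + delta - 1)%N) /\
    (forall j, (1 <= j)%N -> (j < delta)%N -> (xi j.+1 < xi j)%N) /\
    ((0 < delta)%N -> (0 < xi delta)%N) /\
    (forall e, e \in B <->
       (
           (exists2 x : nat, (alpha <= x < alpha + beta)%N &
             e = seg m k x%:Z (x.+1)%:Z) \/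
           (exists2 x : nat, (alpha + beta + 1 <= x < m - delta)%N &
             e = seg m k x%:Z (x.+1)%:Z) \/
           (e = seg m k ((alpha + beta)%N%:Z - eta%:Z) ((alpha + beta + 1 + eta)%N%:Z)) \/
           (exists2 i : nat, (1 <= i <= alpha)%N &
             e = seg m k (i%:Z - 1 - (eps i)%:Z) (i%:Z + (eps i)%:Z)) \/
           (exists2 j : nat, (1 <= j <= delta)%N &
             e = seg m k (m%:Z - j%:Z - (xi j)%:Z) (m%:Z - j%:Z + 1 + (xi j)%:Z)))).

(* Main.v *)
(* Blocking. A simple Hamiltonian path visits growing intervals
   [lo t, hi t] of Z/(2m-1), each step adding one of the two neighbours of the
   current interval. Suppose it avoids B, and let I be the arc <al, ..., m-de>,
   all of whose boundary edges but the gap [c, c+1], c = alpha + beta, lie in B.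
   The path can neither start nor end inside I: its first edge would be the gap,
   after which it is forced to zigzag around the gap until it uses the edge (3).
   Hence, up to reversal, the interior of I is swept in increasing order by hi.
   If the interval is [a, x] when x is reached, the edges at x are [a, x] and
   [a-1, x] (except at the gap). Put tau x = a + x. Then tau never increases,
   except by at most 1 across the gap. Initially tau <= 2 al; avoiding the edges
   (4) one after the other forces tau <= 0 before the gap, hence tau <= 1 after
   it, and avoiding the edges (5) forces tau <= 1 - 2 de at the end of I, where
   there is not enough room left outside I for this.

   Minimality. The edges {a, b} of the zigzag path centred at j satisfy
   a + b = 2j or 2j + 1 mod 2m-1, so an edge lies in at most two of these 2m-1
   paths, and a blocking set C satisfies 2m-1 <= 2 #|C|. *)

Require Import Defs.
From mathcomp Require Import all_boot all_order all_algebra.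
From mathcomp Require Import zify.

Set Implicit Arguments.
Unset Strict Implicit.
Unset Printing Implicit Defensive.

Import Order.TTheory GRing.Theory Num.Theory.
Local Open Scope ring_scope.

(** * Integer lifts of the cyclic labels, and crossings *)

Lemma val_vtx m (k x : int) :
  (vtx m k x : nat)%:Z = ((x + k) %% ((2 * m.-1).+1)%:Z)%Z.
Proof.
rewrite /vtx inordK; last first.
  by have := @ltz_pmod (x + k) (2 * m.-1).+1%:Z isT; have := @modz_ge0 (x + k) (2 * m.-1).+1%:Z isT; lia.
by rewrite gez0_abs // modz_ge0.
Qed.

Lemma val_vtxD m (k x : int) (d : nat) : (d < (2 * m.-1).+1)%N ->
  (vtx m k (x + d%:Z) : nat) =
  (if vtx m k x + d < (2 * m.-1).+1 then vtx m k x + d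
   else vtx m k x + d - (2 * m.-1).+1)%N.
Proof.
move=> ltdN; apply/eqP; rewrite -eqz_nat val_vtx addrAC -modzDml -(val_vtx m k x).
have ltxN := ltn_ord (vtx m k x); apply/eqP.
case: ltnP => ?; first by rewrite modz_small //; lia.
have -> : (vtx m k x)%:Z + d%:Z =
  (vtx m k x + d - (2 * m.-1).+1)%N%:Z + (2 * m.-1).+1%:Z by lia.
by rewrite modzDr modz_small //; lia.
Qed.

Lemma vtx_period m (k x : int) : vtx m k (x + ((2 * m.-1).+1)%:Z) = vtx m k x.
Proof. by apply/val_inj/eqP; rewrite /= -eqz_nat !val_vtx addrAC modzDr. Qed.

Lemma vtx_inj m (k x y : int) : vtx m k x = vtx m k y ->
  (x < y + ((2 * m.-1).+1)%:Z) -> (y < x + ((2 * m.-1).+1)%:Z) -> x = y.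
Proof.
move=> /(congr1 val) /eqP; rewrite /= -eqz_nat !val_vtx eqz_mod_dvd.
move=> /dvdzP[q]; set n := (2 * m.-1).+1; have : (0 < n)%N by [].
move: n => n; case: q => [[|q]|q] n0 e l1 l2; nia.
Qed.

Lemma vtx_onto m (k : int) (w : VT m) (l : int) :
  exists x : int, [/\ l <= x, x < l + ((2 * m.-1).+1)%:Z & w = vtx m k x].
Proof.
set z := ((w : nat)%:Z - k - l).
have := @ltz_pmod z (2 * m.-1).+1%:Z isT.
have := @modz_ge0 z (2 * m.-1).+1%:Z isT.
exists (l + (z %% ((2 * m.-1).+1)%:Z)%Z); split; try lia.
apply/val_inj/eqP; rewrite /= -eqz_nat val_vtx addrAC modzDmr.
have -> : l + k + z = w%:Z by rewrite /z; lia.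
by rewrite modz_small //; have := ltn_ord w; lia.
Qed.

(** [cross] refers to the linear order of labels, so there are four cases, according to how many of
    [y], [z], [w] have wrapped past label 0; the edge holding the least label comes first. *)
Lemma cross_vtx m (k x y z w : int) :
  x < y -> y < z -> z < w -> w < x + ((2 * m.-1).+1)%:Z ->
  cross [set vtx m k x; vtx m k z] [set vtx m k y; vtx m k w] \/
  cross [set vtx m k y; vtx m k w] [set vtx m k x; vtx m k z].
Proof.
move=> xy yz zw wx.
have shift u : x < u -> u < x + ((2 * m.-1).+1)%:Z -> exists2 d : nat,
    (d < (2 * m.-1).+1)%N & u = x + d%:Z by move=> ? ?; exists `|u - x|%N; lia.
have [//||a la ea] := shift y; first lia.
have [||b lb eb] := shift z; try lia.
have [||c lc ec] := shift w; try lia.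
have := val_vtxD k x la; have := val_vtxD k x lb; have := val_vtxD k x lc.
have lx := ltn_ord (vtx m k x).
rewrite -ea -eb -ec.
case: ltnP => hc; case: ltnP => hb; case: ltnP => ha vc vb va; try lia.
- by left; exists (vtx m k x), (vtx m k z), (vtx m k y), (vtx m k w); do !split => //; lia.
- right; exists (vtx m k w), (vtx m k y), (vtx m k x), (vtx m k z).
  by do !split; [exact: setUC|lia].
- left; exists (vtx m k z), (vtx m k x), (vtx m k w), (vtx m k y).
  by do !split; [exact: setUC|exact: setUC|lia].
- right; exists (vtx m k y), (vtx m k w), (vtx m k z), (vtx m k x).
  by do !split; [exact: setUC|lia].
Qed.

Lemma bool_switch (s : nat -> bool) (i j : nat) : (i <= j)%N -> s i != s j ->
  exists2 u, (i <= u < j)%N & s u != s u.+1.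
Proof.
elim: j => [|j IH].
  by rewrite leqn0 => /eqP->; rewrite eqxx.
rewrite leq_eqVlt => /orP[/eqP->|]; first by rewrite eqxx.
move=> ij sij; case: (eqVneq (s i) (s j)) => [e|ne].
  by exists j; [lia|rewrite -e].
have [u ? ?] := IH ij ne; exists u => //; lia.
Qed.

(** * Simple Hamiltonian paths as growing intervals *)

Section Path.

Variables (m : nat) (k : int) (P : nat -> VT m).
Local Notation N := (2 * m.-1).+1.
Local Notation v := (vtx m k).

Definition simple_path :=
  (forall i j, (i < N)%N -> (j < N)%N -> P i = P j -> i = j) /\
  (forall i j, (i.+1 < N)%N -> (j.+1 < N)%N ->
    ~ cross [set P i; P i.+1] [set P j; P j.+1]).

Definition traverses (x y : int) :=
  exists2 t, (t.+1 < N)%N & [set P t; P t.+1] = [set v x; v y].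

Hypothesis SP : simple_path.
Let Pinj := proj1 SP.
Let Pcross := proj2 SP.

Lemma simple_path_onto w : exists2 t, (t < N)%N & P t = w.
Proof.
have injP : injective ((fun i => P i) : 'I_N -> 'I_N).
  by move=> i j; move/Pinj => e; apply/val_inj/e; exact: ltn_ord.
have [g _ fg] := injF_bij injP.
by exists (g w); [exact: ltn_ord|exact: fg].
Qed.

Variable a0 : int.

(* [lo t] and [hi t] lift the ends of the set of the first [t + 1] vertices to
   integers, starting from the lift [a0] of the first vertex. *)
Fixpoint lo (t : nat) : int :=
  if t is u.+1 then (if P u.+1 == v (lo u - 1) then lo u - 1 else lo u)
  else a0.

Definition hi t := lo t + t%:Z.

Lemma lo_le_start t : lo t <= a0.
Proof. by elim: t => //= t IH; case: ifP => _; lia. Qed.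

Hypothesis P0 : P 0%N = v a0.

(** The last clause keeps the current vertex at an end of the interval, so that the next edge
    separates the unvisited vertices into two sides. *)
Definition visits_interval t :=
  [/\ forall u, (u <= t)%N -> exists x : int, [/\ lo t <= x, x <= hi t & P u = v x],
      forall x : int, lo t <= x -> x <= hi t -> exists2 u, (u <= t)%N & P u = v x &
      P t = v (lo t) \/ P t = v (hi t)].

Definition extends_interval t :=
  (P t.+1 = v (lo t - 1) /\ lo t.+1 = lo t - 1) \/
  (P t.+1 = v (hi t + 1) /\ lo t.+1 = lo t).

(* Otherwise unvisited vertices remain on both sides of the edge to the next
   vertex [w], and the rest of the path crosses that edge. *)
Lemma next_vertex t :
  (t.+1 < N)%N -> visits_interval t -> extends_interval t.
Proof.
move=> lt1N [A1 A2 A3].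
suff : P t.+1 = v (lo t - 1) \/ P t.+1 = v (hi t + 1).
  rewrite /extends_interval /=; case: eqP => [e _|ne [e|e]]; [by left|by case: ne|by right].
have hE : hi t = lo t + t%:Z by [].
have [w [w1 w2 ew]] := vtx_onto k (P t.+1) (lo t).
have wh : hi t < w.
  rewrite ltNge; apply/negP => wh; have [u ut eu] := A2 w w1 wh.
  have : t.+1 = u by apply: Pinj; [|lia|rewrite ew eu].
  lia.
case: (eqVneq w (hi t + 1)) => [e|n1]; first by right; rewrite ew e.
case: (eqVneq w (lo t - 1 + N%:Z)) => [e|n2].
  by left; rewrite ew e vtx_period.
exfalso.
have late u : (t < u)%N -> (u < N)%N ->
    exists z : int, [/\ hi t < z, z < lo t + N%:Z & P u = v z].
  move=> tu uN; have [z [z1 z2 ez]] := vtx_onto k (P u) (lo t).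
  exists z; split=> //; rewrite ltNge; apply/negP => zh.
  have [u' ut' eu'] := A2 z z1 zh.
  have : u = u' by apply: Pinj; [|lia|rewrite ez eu'].
  lia.
have hit (z : int) : hi t < z -> z < lo t + N%:Z -> z != w ->
    exists2 u, (t.+1 < u < N)%N & P u = v z.
  move=> z1 z2 zw; have [u uN eu] := simple_path_onto (v z).
  exists u => //; rewrite uN andbT ltnNge; apply/negP.
  rewrite leq_eqVlt ltnS => /orP[/eqP e|ut].
    move: eu; rewrite e ew => /vtx_inj e1.
    by case/eqP: zw; rewrite e1 //; lia.
  have [z' [z'1 z'2 ez]] := A1 u ut.
  by have : z = z' by [apply: (@vtx_inj m k); [rewrite -eu|lia|lia]]; lia.
(* [side u] means that [P u] lies strictly between [hi t] and [w]; bounding the offset by [2 * N]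
   makes this a boolean. *)
pose side u := [exists z : 'I_(2 * N), (hi t < lo t + z%:Z < w) && (P u == v (lo t + z%:Z))].
have sideP u (z : int) : hi t < z -> z < lo t + N%:Z -> P u = v z -> side u = (z < w).
  move=> z1 z2 ez; apply/existsP/idP => [[y /andP[/andP[y1 y2] /eqP ey]]|zw].
    by rewrite (@vtx_inj m k z (lo t + y%:Z)) -?ez //; lia.
  have lz : (`|z - lo t| < 2 * N)%N by lia.
  exists (Ordinal lz) => /=.
  have -> : lo t + (`|z - lo t|%N)%:Z = z by lia.
  by rewrite z1 zw ez eqxx.
have [|||u1 hu1 eu1] := hit (hi t + 1); try lia.
have [|||u2 hu2 eu2] := hit (lo t - 1 + N%:Z); try lia.
have s1 : side u1 by rewrite (sideP _ (hi t + 1)) //; lia.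
have s2 : side u2 = false by rewrite (sideP _ (lo t - 1 + N%:Z)) //; lia.
have [u hu su] : exists2 u, (t.+1 < u)%N && (u.+1 < N)%N & side u != side u.+1.
  case: (leqP u1 u2) => le12.
    by have [||u ? ?] := @bool_switch side u1 u2; rewrite ?s1 ?s2 //; exists u => //; lia.
  by have [||u ? ?] := @bool_switch side u2 u1; rewrite ?s1 ?s2 //; [lia|exists u => //; lia].
have [||z [z1 z2 ez]] := late u; try lia.
have [||y [y1 y2 ey]] := late u.+1; try lia.
rewrite (sideP _ _ z1 z2 ez) (sideP _ _ y1 y2 ey) in su.
have nw (q : int) i : P i = v q -> (t.+1 < i < N)%N -> q != w.
  move=> eiq ilt; apply/eqP => e.
  by have : i = t.+1 by [apply: Pinj; [lia|lia|rewrite eiq e ew]]; lia.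
have nz : z != w by apply: (nw _ u) => //; lia.
have ny : y != w by apply: (nw _ u.+1) => //; lia.
have uN : (u.+1 < N)%N by lia.
have nc1 := Pcross lt1N uN; have nc2 := Pcross uN lt1N.
rewrite ez ey ew in nc1 nc2.
have main (p q : int) : hi t < p -> p < w -> w < q -> q < lo t + N%:Z ->
    cross [set P t; v w] [set v p; v q] \/ cross [set v p; v q] [set P t; v w].
  move=> p1 p2 q1 q2; case: A3 => ->; last by apply: cross_vtx; lia.
  rewrite -(vtx_period m k (lo t)) [[set v (_ + _); _]]setUC.
  by case: (@cross_vtx m k p w q (lo t + N%:Z)) => //; try lia; auto.
case: (ltP z w) su => zw; case: (ltP y w) => yw // _.
  by case: (main z y) => //; lia.
rewrite [[set v z; v y]]setUC in nc1 nc2.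
by case: (main y z) => //; lia.
Qed.

Lemma visits_interval_all t : (t < N)%N -> visits_interval t.
Proof.
elim: t => [|t IH] ltN.
  split=> [u|x|]; last by left.
    by rewrite leqn0 => /eqP->; exists a0; rewrite /hi /=; split; [lia|lia|].
  by rewrite /hi /= => ? ?; exists 0%N => //; rewrite P0; congr v; lia.
have [A1 A2 A3] := IH (ltnW ltN).
have [[eP el]|[eP el]] := next_vertex ltN (And3 A1 A2 A3).
  have eh : hi t.+1 = hi t by rewrite /hi el; lia.
  split; rewrite ?eh ?el ?eP; last by left.
    move=> u; rewrite leq_eqVlt ltnS => /orP[/eqP->|/A1[x [x1 x2 ex]]].
      by exists (lo t - 1); rewrite /hi; split=> //; lia.
    by exists x; split=> //; lia.
  move=> x x1 x2; case: (eqVneq x (lo t - 1)) => [->|nx]; first by exists t.+1.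
  by have [||u ut eu] := A2 x; [lia|lia|exists u => //; lia].
have eh : hi t.+1 = hi t + 1 by rewrite /hi el; lia.
split; rewrite ?eh ?el ?eP; last by right.
  move=> u; rewrite leq_eqVlt ltnS => /orP[/eqP->|/A1[x [x1 x2 ex]]].
    by exists (hi t + 1); rewrite /hi; split=> //; lia.
  by exists x; split=> //; lia.
move=> x x1 x2; case: (eqVneq x (hi t + 1)) => [->|nx]; first by exists t.+1.
by have [||u ut eu] := A2 x; [lia|lia|exists u => //; lia].
Qed.

Lemma simple_path_step t : (t.+1 < N)%N -> extends_interval t.
Proof. by move=> ltN; apply/next_vertex/visits_interval_all/ltnW. Qed.

Lemma traverses_step t x y :
  (t.+1 < N)%N -> P t = v x -> P t.+1 = v y -> traverses x y.
Proof. by move=> ltN ex ey; exists t => //; rewrite ex ey. Qed.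

Lemma traversesC x y : traverses x y -> traverses y x.
Proof. by case=> t ltN e; exists t => //; rewrite e setUC. Qed.

Lemma traverses_period x y : traverses x y -> traverses y (x + N%:Z).
Proof. by case=> t ltN e; exists t => //; rewrite vtx_period e setUC. Qed.

Lemma start_outside_arc (l c r : int) (eta : nat) :
  r - l < N%:Z -> l < c - eta%:Z -> c + 1 + eta%:Z < r ->
  (forall x, l <= x -> x < r -> x != c -> ~ traverses x (x + 1)) ->
  ~ traverses (c - eta%:Z) (c + 1 + eta%:Z) ->
  a0 <= l \/ r <= a0.
Proof.
move=> lrN lc cr arc chord.
case: (leP a0 l) => la; first by left.
case: (leP r a0) => ra; first by right.
(* Invariant: after [2 * i + 2] vertices the visited interval is [[c - i, c + 1 + i]], and the last
   edge joins its ends, in one direction or the other. At [i = eta] this edge is the excluded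
   chord. *)
exfalso; suff zigzag i : (i <= eta)%N -> lo (2 * i).+1 = c - i%:Z /\
    ((P (2 * i)%N = v (c - i%:Z) /\ P (2 * i).+1 = v (c + 1 + i%:Z)) \/
     (P (2 * i)%N = v (c + 1 + i%:Z) /\ P (2 * i).+1 = v (c - i%:Z))).
  have ltN : ((2 * eta).+1 < N)%N by lia.
  apply: chord; have [_ [[e1 e2]|[e1 e2]]] := zigzag _ (leqnn eta).
    exact: traverses_step ltN e1 e2.
  exact/traversesC/(traverses_step ltN e1 e2).
elim: i => [_|i IH lti].
  have lt1N : (1 < N)%N by lia.
  have := simple_path_step lt1N; rewrite /extends_interval /hi /= => -[[e1 el]|[e1 el]].
    have tr : traverses (a0 - 1) (a0 - 1 + 1).
      by rewrite subrK; apply/traversesC/(traverses_step lt1N P0 e1).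
    have ac : a0 - 1 = c.
      by apply/eqP/negPn/negP => ne; apply: (arc (a0 - 1)) => //; lia.
    split; first by rewrite muln0 /= el ac; lia.
    by right; rewrite muln0 P0 e1; split; congr v; lia.
  have tr : traverses a0 (a0 + 1).
    by apply: (traverses_step lt1N P0); rewrite e1; congr v; lia.
  have ac : a0 = c by apply/eqP/negPn/negP => ne; apply: (arc a0) => //; lia.
  split; first by rewrite muln0 /= el ac; lia.
  by left; rewrite muln0 P0 e1; split; congr v; lia.
have [el] := IH (ltnW lti).
have -> : (2 * i.+1 = (2 * i).+2)%N by lia.
have lt2N : ((2 * i).+2 < N)%N by lia.
have lt3N : ((2 * i).+3 < N)%N by lia.
have := simple_path_step lt2N; have := simple_path_step lt3N.
rewrite /extends_interval /hi el.
(* Continuing on the side just reached would use a boundary edge of the arc, so each of the next two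
   steps changes side. *)
move=> S3 S2 [[_ eP]|[_ eP]].
  case: S2 => -[e2 el2]; last first.
    exfalso; apply: (arc (c + 1 + i%:Z)); try lia.
    by apply: (traverses_step lt2N eP); rewrite e2; congr v; lia.
  case: S3; rewrite el2 => -[e3 el3].
    exfalso; apply: (arc (c - i%:Z - 1 - 1)); try lia.
    by rewrite subrK; apply/traversesC/(traverses_step lt3N e2 e3).
  split; first lia.
  by left; rewrite e2 e3; split; congr v; lia.
case: S2 => -[e2 el2].
  exfalso; apply: (arc (c - i%:Z - 1)); try lia.
  by rewrite subrK; apply/traversesC/(traverses_step lt2N eP e2).
case: S3; rewrite el2 => -[e3 el3]; last first.
  exfalso; apply: (arc (c + 1 + i%:Z + 1)); try lia.
  by apply: (traverses_step lt3N); [rewrite e2|rewrite e3]; congr v; lia.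
split; first lia.
by right; rewrite e2 e3; split; congr v; lia.
Qed.

Lemma hi_step t : (t.+1 < N)%N -> hi t <= hi t.+1 <= hi t + 1.
Proof.
by move=> /simple_path_step; rewrite /extends_interval /hi => -[[_ ->]|[_ ->]]; lia.
Qed.

Lemma hi_le s t : (s <= t)%N -> (t < N)%N -> hi s <= hi t.
Proof.
elim: t => [|t IH]; first by rewrite leqn0 => /eqP->.
rewrite leq_eqVlt => /orP[/eqP->//|st] ltN.
by have := IH st (ltnW ltN); have := hi_step ltN; lia.
Qed.

(** The bound [t.+2 < N] ensures that the path goes on after [x], so that [x] has two path edges. *)
Definition reached (x : int) t := [/\ (t.+2 < N)%N, hi t = x - 1 & hi t.+1 = x].

Definition reach_time (x : int) := find (fun t => x <= hi t.+1) (iota 0 (N - 2)).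

(** [hi] starts at [a0 < x] and grows by at most 1 per step, so it equals [x] when it first is at
    least [x]. *)
Lemma reach_timeP x : (2 < N)%N -> a0 < x -> x <= hi (N - 2)%N -> reached x (reach_time x).
Proof.
move=> N2 ax xh; have hasx : has (fun t => x <= hi t.+1) (iota 0 (N - 2)).
  apply/hasP; exists (N - 3)%N; first by rewrite mem_iota; lia.
  by have -> : ((N - 3).+1 = N - 2)%N by lia.
have := nth_find 0%N hasx; have := hasx.
rewrite has_find size_iota -/(reach_time x) => ltf.
rewrite nth_iota // add0n => xle.
have ltN : ((reach_time x).+2 < N)%N by lia.
suff hlt : hi (reach_time x) < x.
  by have := hi_step (ltnW ltN); rewrite /reached; split=> //; lia.
case ef: (reach_time x) ltf => [|f] ltf; first by rewrite /hi /=; lia.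
have /(@before_find _ 0%N) : (f < reach_time x)%N by rewrite ef.
by rewrite nth_iota ?add0n; lia.
Qed.

(** Between the two times [hi] grows by 1, so [lo] drops by [t - s - 1]. A zero drop means
    [t = s + 1], and then the path goes straight from [x] to [x + 1]. *)
Lemma reached_succ x s t : reached x s -> reached (x + 1) t ->
  lo t.+1 <= lo s.+1 /\ (~ traverses x (x + 1) -> lo t.+1 < lo s.+1).
Proof.
move=> [sN s1 s2] [tN t1 t2].
have st : (s < t)%N.
  rewrite ltnNge; apply/negP => /hi_le => /(_ (ltnW (ltnW sN))); lia.
have := hi_le st (ltnW (ltnW tN)); rewrite /hi in s1 s2 t1 t2 *.
move=> _; split; first lia.
move=> ntr; case: (eqVneq t s.+1) => [e|ne]; last lia.
exfalso; apply: ntr; subst t; apply: (traverses_step (ltnW tN)).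
  have [[_ e]|[-> _]] := simple_path_step (ltnW sN); first lia.
  by rewrite /hi; congr v; lia.
have [[_ e]|[-> _]] := simple_path_step (ltnW tN); first lia.
by rewrite /hi; congr v; lia.
Qed.

(** The path can neither arrive from [x - 1] nor leave to [x + 1], so it comes from the low end of
    the interval and leaves to the vertex just below that end. *)
Lemma reached_traverses x t : reached x t ->
  ~ traverses (x - 1) x -> ~ traverses x (x + 1) ->
  traverses (lo t.+1) x /\ traverses (lo t.+1 - 1) x.
Proof.
move=> [tN t1 t2] n1 n2; have ltN := ltnW tN.
have [[_ el]|[eP el]] := simple_path_step ltN; first by rewrite /hi in t1 t2; lia.
rewrite t1 subrK in eP.
have [_ _ [e0|e0]] := visits_interval_all (ltnW ltN); last first.
  by case: n1; apply: traverses_step ltN _ eP; rewrite e0 t1.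
split; first by rewrite el; apply: traverses_step ltN e0 eP.
have [[e2 _]|[e2 _]] := simple_path_step tN.
  exact/traversesC/(traverses_step tN eP e2).
by case: n2; apply: (traverses_step tN eP); rewrite e2 t2.
Qed.

End Path.

(** * Arithmetic of the sums [tau] along the sweep *)

Lemma strict_decr_bounds n (e : nat -> nat) i :
  (forall i, (1 <= i < n)%N -> (e i.+1 < e i)%N) -> ((0 < n)%N -> (0 < e n)%N) ->
  (1 <= i <= n)%N -> (n < i + e i <= (e 1%N).+1)%N.
Proof.
move=> dec pos ni; apply/andP; split.
  have [d] : exists d, (i + d = n)%N by exists (n - i)%N; lia.
  elim: d i ni => [|d IH] i ni ed; last by have := IH i.+1; have := dec i; lia.
  have ei : i = n by lia.
  by rewrite ei in ni *; have := pos; lia.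
case: i ni => // i; elim: i => [|i IH] ni; first by lia.
by have := dec i.+1; lia.
Qed.

Section Sweep.

Variables (m al de c : nat) (eps xi : nat -> nat).
Hypotheses (alc : (al < c)%N) (cm : (c.+2 < m - de)%N).
Hypotheses (eps_lt : forall i, (1 <= i <= al)%N -> (al < i + eps i < c)%N)
  (eps_dec : forall i, (1 <= i < al)%N -> (eps i.+1 < eps i)%N).
Hypotheses (xi_lt : forall j, (1 <= j <= de)%N -> (de < j + xi j)%N && (c.+1 + j + xi j < m)%N)
  (xi_dec : forall j, (1 <= j < de)%N -> (xi j.+1 < xi j)%N).

(* [tau x] and [tau x - 1] are the endpoint sums of the two edges at [x]; the
   edges (4) have sums 2i-1 and the edges (5) have sums 2-2j mod 2m-1. *)
Variable tau : int -> int.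
Hypotheses
  (tau_dec : forall x, al%:Z < x -> x + 1 < m%:Z - de%:Z -> x != c%:Z ->
     tau (x + 1) <= tau x)
  (tau_gap : tau (c%:Z + 1) <= tau c%:Z + 1)
  (tau_al : tau (al%:Z + 1) <= 2 * al%:Z)
  (tau_eps : forall i, (1 <= i <= al)%N ->
     tau (i%:Z + (eps i)%:Z) != 2 * i%:Z - 1 /\ tau (i%:Z + (eps i)%:Z) != 2 * i%:Z)
  (tau_xi : forall j, (1 <= j <= de)%N ->
     tau (m%:Z - j%:Z - (xi j)%:Z) != 2 - 2 * j%:Z /\
     tau (m%:Z - j%:Z - (xi j)%:Z) != 3 - 2 * j%:Z).

Lemma tau_le (x y : int) : al%:Z < x -> x <= y -> y < m%:Z - de%:Z ->
  y <= c%:Z \/ c%:Z < x -> tau y <= tau x.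
Proof.
move=> ax xy ym xc; have -> : y = x + `|y - x|%N%:Z by lia.
have : x + `|y - x|%N%:Z <= y by lia.
elim: `|y - x|%N => [|d IH] le; first by rewrite addr0.
have := @tau_dec (x + d%:Z); have -> : x + d.+1%:Z = x + d%:Z + 1 by lia.
by move=> H; apply: le_trans (IH _); [apply: H|]; lia.
Qed.

Lemma tau_end : tau (m%:Z - de%:Z - 1) <= 1 - 2 * de%:Z.
Proof.
(* As [i] decreases from [al], the position [i + eps i] moves right, so the bound [2 * i] on [tau]
   is inherited; excluding [2 * i] and [2 * i - 1] lowers it to the bound inherited by [i - 1]. *)
have leg d i : (i + d = al)%N -> (0 < i)%N -> tau (i%:Z + (eps i)%:Z) <= 2 * i%:Z - 2.
  elim: d i => [|d IH] i e i1.
    have [|n1 n2] := @tau_eps i; first lia.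
    have := @tau_le (al%:Z + 1) (i%:Z + (eps i)%:Z).
    have := @eps_lt i; lia.
  have [|n1 n2] := @tau_eps i; first lia.
  have := IH i.+1; have := @eps_dec i; have := @eps_lt i; have := @eps_lt i.+1.
  have := @tau_le (i.+1%:Z + (eps i.+1)%:Z) (i%:Z + (eps i)%:Z).
  lia.
have tauc : tau c%:Z <= 0.
  case: (posnP al) => a0.
    by have := @tau_le (al%:Z + 1) c%:Z; lia.
  have := leg al.-1 1%N; have := @eps_lt 1%N.
  by have := @tau_le (1%N%:Z + (eps 1)%:Z) c%:Z; lia.
(* Same descent with [j] increasing, from the bound 1 just after the gap: each [j] excludes the top
   two values and lowers the bound by 2. *)
have legr j : (0 < j)%N -> (j <= de)%N ->
    tau (m%:Z - j%:Z - (xi j)%:Z) <= 1 - 2 * j%:Z.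
  elim: j => [//|j IH] _ jd.
  have [|n1 n2] := @tau_xi j.+1; first lia.
  have := @xi_lt j.+1.
  case: (posnP j) => j0.
    have := @tau_le (c%:Z + 1) (m%:Z - j.+1%:Z - (xi j.+1)%:Z); lia.
  have := @xi_dec j; have := @xi_lt j; have := IH j0.
  have := @tau_le (m%:Z - j%:Z - (xi j)%:Z) (m%:Z - j.+1%:Z - (xi j.+1)%:Z).
  lia.
case: (posnP de) => d0.
  by have := @tau_le (c%:Z + 1) (m%:Z - de%:Z - 1); lia.
have := legr de; have := @xi_lt de.
by have := @tau_le (m%:Z - de%:Z - (xi de)%:Z) (m%:Z - de%:Z - 1); lia.
Qed.

End Sweep.

(** * No simple Hamiltonian path avoids a Class B set *)

Lemma simple_path_rev m (P : nat -> VT m) :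
  simple_path P -> simple_path (fun i => P (2 * m.-1 - i)%N).
Proof.
move=> [inj ncross]; split=> [i j ilt jlt /inj|i j ilt jlt].
  by move=> H; have := H; lia.
have ei : ((2 * m.-1 - i) = (2 * m.-1 - i.+1).+1)%N by lia.
have ej : ((2 * m.-1 - j) = (2 * m.-1 - j.+1).+1)%N by lia.
by rewrite ei ej ![[set P _.+1; _]]setUC; apply: ncross; lia.
Qed.

Lemma traverses_rev m (k : int) (P : nat -> VT m) x y :
  traverses k (fun i => P (2 * m.-1 - i)%N) x y -> traverses k P x y.
Proof.
case=> t ltN e; exists (2 * m.-1 - t.+1)%N; first lia.
have -> : ((2 * m.-1 - t.+1).+1 = 2 * m.-1 - t)%N by lia.
by rewrite setUC.
Qed.

Section Avoiding.

Variables (m : nat) (k : int) (al de c eta : nat) (eps xi : nat -> nat).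
Hypotheses (alc : (al.+1 < c)%N) (cm : (c.+2 < m - de)%N) (adm : (al + de + 5 <= m)%N).
Hypotheses (eta_al : (al + eta < c)%N) (eta_de : (c.+1 + eta < m - de)%N).
Hypotheses (eps_lt : forall i, (1 <= i <= al)%N -> (al < i + eps i < c)%N)
  (eps_dec : forall i, (1 <= i < al)%N -> (eps i.+1 < eps i)%N).
Hypotheses (xi_lt : forall j, (1 <= j <= de)%N -> (de < j + xi j)%N && (c.+1 + j + xi j < m)%N)
  (xi_dec : forall j, (1 <= j < de)%N -> (xi j.+1 < xi j)%N).
Local Notation N := (2 * m.-1).+1.
Local Notation v := (vtx m k).

Definition avoids (P : nat -> VT m) :=
  [/\ forall x : int, al%:Z <= x -> x < m%:Z - de%:Z -> x != c%:Z -> ~ traverses k P x (x + 1),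
      ~ traverses k P (c%:Z - eta%:Z) (c%:Z + 1 + eta%:Z),
      forall i, (1 <= i <= al)%N ->
        ~ traverses k P (i%:Z - 1 - (eps i)%:Z) (i%:Z + (eps i)%:Z) &
      forall j, (1 <= j <= de)%N ->
        ~ traverses k P (m%:Z - j%:Z - (xi j)%:Z) (m%:Z - j%:Z + 1 + (xi j)%:Z)].

(** The bound on [hi] at [N - 2] places the sweep of the arc's interior before the last vertex, so
    every swept vertex has both its path edges. *)
Lemma no_upward_sweep P (a0 : int) : simple_path P -> avoids P -> P 0%N = v a0 ->
  a0 <= al%:Z -> m%:Z - de%:Z - 1 <= hi k P a0 (N - 2)%N -> False.
Proof.
move=> SP [arc _ legl legr] P0 a0l hir.
pose f x := reach_time k P a0 x.
have fP x : al%:Z < x -> x < m%:Z - de%:Z -> reached k P a0 x (f x).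
  by move=> ? ?; apply: reach_timeP => //; lia.
have loE x : al%:Z < x -> x < m%:Z - de%:Z -> lo k P a0 (f x).+1 + (f x).+1%:Z = x.
  by move=> h1 h2; have [_ _] := fP x h1 h2; rewrite /hi.
have edges x : al%:Z < x -> x < m%:Z - de%:Z -> x - 1 != c%:Z -> x != c%:Z ->
    traverses k P (lo k P a0 (f x).+1) x /\ traverses k P (lo k P a0 (f x).+1 - 1) x.
  move=> h1 h2 n1 n2; apply: reached_traverses => //; first exact: fP.
    by rewrite -{2}[x](subrK 1); apply: arc => //; lia.
  by apply: arc => //; lia.
pose tau x := lo k P a0 (f x).+1 + x.
have tauE x : tau x = lo k P a0 (f x).+1 + x by [].
suff : tau (m%:Z - de%:Z - 1) <= 1 - 2 * de%:Z.
  set x := m%:Z - de%:Z - 1; rewrite tauE.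
  have [||||_ tr] := edges x; try lia.
  have := loE x; have [||ltN _ _] := fP x; try lia.
  (* At most [N - 1] vertices are visited when [x] is reached, so [lo + x] is at least [1 - 2 * de].
     Equality puts [lo - 1] at [x + 1 - N], and the edge from [x] to it is the boundary edge
     [[x, x + 1]]. *)
  move=> el le; apply: (arc x); try lia.
  have -> : x + 1 = lo k P a0 (f x).+1 - 1 + N%:Z by lia.
  exact: traverses_period.
apply: (tau_end (ltnW alc) cm eps_lt eps_dec xi_lt xi_dec).
- move=> x h1 h2 nc; have [||_ lt] := @reached_succ _ _ _ SP _ P0 x (f x) (f (x + 1)).
  + by apply: fP; lia.
  + by apply: fP; lia.
  by have := lt (arc x _ _ nc); rewrite !tauE; lia.
- have [||le _] := @reached_succ _ _ _ SP _ P0 c%:Z (f c%:Z) (f (c%:Z + 1)).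
  + by apply: fP; lia.
  + by apply: fP; lia.
  by rewrite !tauE; lia.
(* Here [lo] is at most [al], and [lo = al] would put the boundary edge [[al, al + 1]] in the
   path. *)
- rewrite tauE; set x := al%:Z + 1.
  have [||||tr _] := edges x; try lia.
  have := loE x; case: (eqVneq (lo k P a0 (f x).+1) al%:Z) tr => [-> tr|]; last lia.
  by case: (arc al%:Z) => //; lia.
- move=> i il; have := eps_lt il => h1.
  have [||||t1 t2] := edges (i%:Z + (eps i)%:Z); try lia.
  rewrite tauE; split; apply/eqP => e; case: (legl i il).
    by rewrite (_ : i%:Z - 1 - _ = lo k P a0 (f (i%:Z + (eps i)%:Z)).+1) //; lia.
  by rewrite (_ : i%:Z - 1 - _ = lo k P a0 (f (i%:Z + (eps i)%:Z)).+1 - 1) //; lia.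
(* The upper end of an edge (5) is [lo + N] or [lo - 1 + N], hence the shift by a period. *)
- move=> j hj; have := xi_lt hj => h1.
  have [||||t1 t2] := edges (m%:Z - j%:Z - (xi j)%:Z); try lia.
  rewrite tauE; split; apply/eqP => e; case: (legr j hj).
    have := traverses_period t1; congr traverses; lia.
  have := traverses_period t2; congr traverses; lia.
Qed.

(** Before the last step one vertex remains, and its lift just above the interval is [e + N]. Thus
    [hi = e + N - 1], which is at least [m - de - 1], and the sweep is upward. *)
Lemma ends_not_ordered P (s e : int) : simple_path P -> avoids P ->
  P 0%N = v s -> P (2 * m.-1)%N = v e -> s <= al%:Z ->
  m%:Z - de%:Z - N%:Z <= e -> ~ (e < s).
Proof.
move=> SP AP P0 PN sal ler lts; apply: (no_upward_sweep SP AP P0 sal).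
have lt1N : ((N - 2).+1 < N)%N by lia.
have last_v : v (e + N%:Z) = v (hi k P s (N - 2)%N + 1).
  have eN : (2 * m.-1 = (N - 2).+1)%N by lia.
  rewrite vtx_period -PN [in LHS]eN.
  case: (simple_path_step SP P0 lt1N) => [[-> _]|[-> _]] //.
  by rewrite -vtx_period; congr v; rewrite /hi; lia.
have lo_le := lo_le_start k P s (N - 2)%N.
have := hi_le SP P0 (leq0n (N - 2)%N) (ltnW lt1N).
rewrite {1}/hi /= addr0 => hi_ge.
by have := vtx_inj last_v; rewrite /hi in hi_ge *; lia.
Qed.

Lemma no_avoiding_path P : simple_path P -> ~ avoids P.
Proof.
move=> SP AP; have SP' := simple_path_rev SP.
have AP' : avoids (fun i => P (2 * m.-1 - i)%N).
  case: AP => A1 A2 A3 A4; split=> [x h1 h2 h3||i hi|j hj] /traverses_rev //.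
  - exact: A1.
  - exact: A3.
  - exact: A4.
have [s [s1 s2 es]] := vtx_onto k (P 0%N) (m%:Z - de%:Z - N%:Z).
have [e [e1 e2 ee]] := vtx_onto k (P (2 * m.-1)%N) (m%:Z - de%:Z - N%:Z).
have ee' : P (2 * m.-1 - 0)%N = v e by rewrite subn0.
have es' : P (2 * m.-1 - 2 * m.-1)%N = v s by rewrite subnn.
(* In the chosen window the vertices outside the open arc are lifted to [[m - de - N, al]], where
   the two ends can be compared; reversal exchanges them. *)
have sal : s <= al%:Z.
  case: (AP) => A1 A2 _ _.
  by case: (start_outside_arc SP es _ _ _ A1 A2); lia.
have eal : e <= al%:Z.
  case: (AP') => A1 A2 _ _.
  by case: (start_outside_arc SP' ee' _ _ _ A1 A2); lia.
case: (ltgtP e s) => [es_lt|se_lt|ese].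
- exact: ends_not_ordered SP AP es ee sal e1 es_lt.
- exact: ends_not_ordered SP' AP' ee' es' eal s1 se_lt.
have : 0%N = (2 * m.-1)%N by apply: SP.1; [lia|lia|rewrite es ee ese].
by lia.
Qed.

End Avoiding.

(** * The lower bound from zigzag paths *)

Lemma path_edgesP m (x0 : VT m) (p : seq (VT m)) e :
  reflect (exists2 i, (i.+1 < size p)%N & e = [set nth x0 p i; nth x0 p i.+1])
    (e \in path_edges p).
Proof.
have szE : size (path_edges p) = (size p).-1.
  by rewrite size_map size_zip size_behead; apply/minn_idPr/leq_pred.
have nthE i : (i.+1 < size p)%N ->
    nth set0 (path_edges p) i = [set nth x0 p i; nth x0 p i.+1].
  move=> ip; rewrite (nth_map (x0, x0)); last by rewrite size_zip size_behead; lia.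
  by rewrite nth_zip_cond size_zip size_behead nth_behead ifT //; lia.
apply: (iffP (nthP set0)) => -[i ip ei].
  by exists i; rewrite ?szE in ip *; [lia|rewrite -nthE // -?ei //; lia].
by exists i; rewrite ?nthE ?szE //; lia.
Qed.

Lemma no_small_multiple (n : nat) (x : int) : (n%:Z %| x)%Z -> 0 < x -> x < n%:Z -> False.
Proof. by case/dvdzP=> -[[|q]|q]; nia. Qed.

(** In a regular polygon, edges are parallel exactly when these sums agree mod [2m-1]. *)
Definition edge_sum m (e : {set VT m}) := (\sum_(x in e) (x : nat))%N.

Lemma edge_sum2 m (a b : VT m) : a != b -> edge_sum [set a; b] = (a + b)%N.
Proof. by move=> ab; rewrite /edge_sum big_setU1 ?inE //= big_set1. Qed.

Section Zigzag.

Variable m : nat.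
Hypothesis m1 : (1 < m)%N.
Local Notation N := (2 * m.-1).+1.
Variable j : int.

(** The order is [j, j+1, j-1, j+2, j-2, ...], with consecutive sums alternating between [2j+1] and
    [2j]. *)
Definition zigzag_vtx t := vtx m 0 (if odd t then j + (uphalf t)%:Z else j - (half t)%:Z).

Definition zigzag := [seq zigzag_vtx t | t <- iota 0 N].

Lemma zigzag_inj s t : (s < N)%N -> (t < N)%N -> zigzag_vtx s = zigzag_vtx t -> s = t.
Proof.
move=> sN tN /vtx_inj; case: ifP => os; case: ifP => ot H;
  by have := H _ _; lia.
Qed.

Lemma zigzag_edge_sum e : e \in path_edges zigzag ->
  exists d : bool, (N%:Z %| (edge_sum e)%:Z - (2 * j + (d : nat)%:Z))%Z.
Proof.
move=> /(path_edgesP ord0) [t]; rewrite size_map size_iota => tN ->.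
rewrite !(nth_map 0%N) ?size_iota // ?nth_iota ?add0n //; try lia.
rewrite edge_sum2; last first.
  by apply/eqP => /zigzag_inj; lia.
exists (~~ odd t); rewrite -eqz_mod_dvd PoszD !val_vtx !addr0 modzDm /= uphalfE.
by case: ifP => ot; rewrite ?ot /=; apply/eqP; congr modz; lia.
Qed.

(** If [a < c < b < d], the sums [a + b] and [c + d] differ by at least 2 and at most [N - 2],
    whereas two zigzag edges have sums within 1 of each other mod [N]. *)
Lemma zigzag_SHP : SHP zigzag.
Proof.
split.
  rewrite map_inj_in_uniq ?iota_uniq // => s t.
  by rewrite !mem_iota !add0n => sN tN; apply: zigzag_inj.
split; first by rewrite size_map size_iota card_ord.
move=> e f /zigzag_edge_sum [d1 h1] /zigzag_edge_sum [d2 h2].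
case=> a [b [c [d [ee [ef /andP[/andP[ac cb] bd]]]]]].
have ab : a != b by rewrite neq_ltn (ltn_trans ac cb).
have cd : c != d by rewrite neq_ltn (ltn_trans cb bd).
move: h1 h2; rewrite ee ef !edge_sum2 // => h1 h2.
have ltdN := ltn_ord d; have := rpredB h2 h1.
by move=> /no_small_multiple; apply; case: (d1); case: (d2); lia.
Qed.

End Zigzag.

(** Since [m] is the inverse of 2 mod [2m-1], the centre of a zigzag is recovered as [m * (sum - d)]
    from any of its edges and the bit [d]; so two images of [C] cover all [2m-1] centres. *)
Lemma blocks_card m (C : {set {set VT m}}) : (1 < m)%N -> blocks C -> (m <= #|C|)%N.
Proof.
move=> m1 bC; pose g (d : bool) (e : {set VT m}) :=
  vtx m 0 (m%:Z * ((edge_sum e)%:Z - (d : nat)%:Z)).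
have cov : [set: VT m] \subset (g false @: C) :|: (g true @: C).
  apply/subsetP => j _; have [e /(zigzag_edge_sum m1) [d hd] eC] := bC _ (zigzag_SHP m1 j%:Z).
  suff -> : j = g d e by rewrite inE; case: (d); rewrite imset_f ?orbT.
  apply/val_inj/eqP; rewrite /= -eqz_nat val_vtx addr0.
  have {1}-> : (j : nat)%:Z = ((j : nat)%:Z %% ((2 * m.-1).+1)%:Z)%Z.
    by rewrite modz_small //; have := ltn_ord j; lia.
  rewrite eq_sym eqz_mod_dvd.
  have -> : m%:Z * ((edge_sum e)%:Z - (d : nat)%:Z) - (j : nat)%:Z =
      m%:Z * ((edge_sum e)%:Z - (2 * (j : nat)%:Z + (d : nat)%:Z)) +
      (j : nat)%:Z * ((2 * m.-1).+1)%:Z by nia.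
  by rewrite rpredD ?dvdz_mull.
have := subset_leq_card cov; rewrite cardsT card_ord => le.
have := leq_trans le (leq_trans (leq_card_setU _ _).1
  (leq_add (leq_imset_card (g false) C) (leq_imset_card (g true) C))).
by move: #|C|%N => n; lia.
Qed.

(** * From lists to indexed paths, and conclusion *)

Lemma seg_is_edge m (k x y : int) : x < y -> y < x + ((2 * m.-1).+1)%:Z ->
  is_edge (seg m k x y).
Proof.
move=> xy yx; rewrite /is_edge /seg cards2 eqSS eqb1.
by apply/eqP => /vtx_inj; lia.
Qed.

Lemma SHP_simple_path m (x0 : VT m) p : SHP p -> simple_path (nth x0 p).
Proof.
move=> [up [szp ncross]]; rewrite card_ord in szp.
split=> [i j ilt jlt e|i j ilt jlt].
  by apply/eqP; rewrite -(nth_uniq x0 _ _ up) ?szp // e.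
by apply: ncross; apply/(path_edgesP x0); [exists i|exists j]; rewrite ?szp.
Qed.

Lemma traverses_path_edges m (k : int) (x0 : VT m) p x y : SHP p ->
  traverses k (nth x0 p) x y -> seg m k x y \in path_edges p.
Proof.
move=> [_ [szp _]] [t tN e]; rewrite card_ord in szp.
by apply/(path_edgesP x0); exists t; rewrite ?szp.
Qed.

Theorem theorem2 (m : nat) (B : {set {set VT m}}) :
  (2 <= m)%N -> classB B -> blocker B.
Proof.
move=> m2 [k [al [de [be [ga [eta [eps [xi]]]]]]]].
move=> [be2 [ga2 [adm [bgm [[eta1 etamin] [eps1 [eps_dec [epsal [xi1 [xi_dec [xide BE]]]]]]]]]]].
have {}eps_dec i : (1 <= i < al)%N -> (eps i.+1 < eps i)%N.
  by case/andP; exact: eps_dec.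
have {}xi_dec j : (1 <= j < de)%N -> (xi j.+1 < xi j)%N.
  by case/andP; exact: xi_dec.
(* The upper ends of the edges (4) lie inside the arc before the gap; next, the lower ends of the
   edges (5) lie inside it after the gap. *)
have eps_lt i : (1 <= i <= al)%N -> (al < i + eps i < al + be)%N.
  by move=> hi; have := strict_decr_bounds eps_dec epsal hi; lia.
have xi_lt j : (1 <= j <= de)%N -> (de < j + xi j)%N && ((al + be).+1 + j + xi j < m)%N.
  by move=> hj; have := strict_decr_bounds xi_dec xide hj; lia.
split; last split.
- move=> e /BE [[x hx ->]|[[x hx ->]|[->|[[i hi ->]|[j hj ->]]]]];
    apply: seg_is_edge; try lia.
  + have := eps_lt i hi; lia.
  + have := xi_lt j hj; lia.
- move=> p SHPp; case: (boolP (has (mem B) (path_edges p))) => [/hasP[e ? ?]|/hasPn nB].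
    by exists e.
  exfalso; pose P := nth ord0 p.
  have {}nB x y : seg m k x y \in B -> ~ traverses k P x y.
    by move=> hB /(traverses_path_edges SHPp) /nB /negP; apply.
  apply: (@no_avoiding_path m k al de (al + be) eta eps xi _ _ _ _ _ _ _ _ _ P
    (SHP_simple_path _ SHPp)); try lia; try done.
  split.
  + move=> x x1 x2 x3; apply: nB; apply/BE.
    have [x4|x4] := ltP x (al + be)%N%:Z; [left|right; left].
      by exists `|x|%N; [lia|congr seg; lia].
    by exists `|x|%N; [lia|congr seg; lia].
  + by apply: nB; apply/BE; right; right; left; congr seg; lia.
  + by move=> i hi; apply: nB; apply/BE; do 3 right; left; exists i.
  + by move=> j hj; apply: nB; apply/BE; do 4 right; exists j.
move=> C _ bC; apply: leq_trans (blocks_card m2 bC).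
(* [L] lists the edges of [B]; its length [be + ga + 1 + al + de] equals [m], which bounds the size
   of [B]. *)
pose L := [seq seg m k x%:Z x.+1%:Z | x <- iota al be] ++
  [seq seg m k x%:Z x.+1%:Z | x <- iota (al + be + 1) ga] ++
  [:: seg m k ((al + be)%N%:Z - eta%:Z) ((al + be + 1 + eta)%N%:Z)] ++
  [seq seg m k (i%:Z - 1 - (eps i)%:Z) (i%:Z + (eps i)%:Z) | i <- iota 1 al] ++
  [seq seg m k (m%:Z - j%:Z - (xi j)%:Z) (m%:Z - j%:Z + 1 + (xi j)%:Z) | j <- iota 1 de].
have szL : size L = m by rewrite !size_cat !size_map !size_iota /=; lia.
rewrite -[leqRHS]szL; apply: leq_trans (card_size L); apply/subset_leq_card/subsetP => e.
rewrite !mem_cat inE => /BE [[x hx ->]|[[x hx ->]|[->|[[i hi ->]|[j hj ->]]]]].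
- by apply/orP; left; apply/mapP; exists x => //; rewrite mem_iota; lia.
- by apply/orP; right; apply/orP; left; apply/mapP; exists x => //; rewrite mem_iota; lia.
- by rewrite eqxx !orbT.
- by do 3 (apply/orP; right); apply/orP; left; apply/mapP; exists i => //; rewrite mem_iota; lia.
- by do 4 (apply/orP; right); apply/mapP; exists j => //; rewrite mem_iota; lia.
Qed.
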